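(* Let $G=(V,E)$ be a (finite or infinite) regular, bipartite, simple, connected graph. Then simple random walk on $G$ satisfies, for each $x\in V$ and each even integer $t\ge2$, $$0\le p_t(x,x)-2\pi(x)\le\frac{18}{\sqrt t}.$$
   Context: Graphs are undirected, unweighted and locally finite (finite degrees $d(x)$). $\pi(x)=d(x)/(2|E|)$, which is $0$ if $G$ is infinite. Simple random walk moves from a vertex to a uniformly random neighbour; $p_t(x,y)$ is the probability that the walk started at $x$ is at $y$ at step $t$. *)

(* Defs.v *)
From mathcomp Require Import all_boot all_order all_algebra finmap.
From mathcomp Require Import all_classical all_reals.
Set Implicit Arguments.
Unset Strict Implicit.
Unset Printing Implicit Defensive.
Import Order.TTheory GRing.Theory Num.Theory.
Local Open Scope classical_set_scope.
Local Open Scope ring_scope.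

Record simple_graph (V : choiceType) := SimpleGraph {
  adj : rel V;
  adj_sym : symmetric adj;
  adj_irrefl : irreflexive adj
}.

Section Graphs.
Variables (V : choiceType) (G : simple_graph V).

Definition nbh (x : V) : set V := [set y | adj G x y].

Definition edges : set {fset V} :=
  [set e | exists x y, adj G x y /\ e = [fset x; y]%fset].

Definition locally_finite : Prop := forall x, finite_set (nbh x).

(* [fset_set A] is the empty set when [A] is infinite, so this is the degree
   only for locally finite graphs. *)
Definition deg (x : V) : nat := #|` fset_set (nbh x)|.

Definition regular : Prop := exists d : nat, forall x, deg x = d.

Definition bipartite : Prop :=
  exists c : V -> bool, forall x y, adj G x y -> c x != c y.

Definition connected : Prop :=
  forall x y, exists2 s : seq V, path (adj G) x s & last x s = y.

Variable R : realType.

(* A finite vertex set forces finitely many edges, so in the first branch the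
   denominator is twice the actual number of edges. *)
Definition pi_stat (x : V) : R :=
  if `[< finite_set [set: V] >]
  then (deg x)%:R / (2 * #|` fset_set edges|%:R)
  else 0.

Definition srw_step (x y : V) : R :=
  if adj G x y then (deg x)%:R^-1 else 0.

(* [srw_prob t x y] is the probability that the walk started at [x] is at [y]
   at step [t], computed by conditioning on the first step.  At an isolated
   vertex no step is possible: the sum is empty and the value is 0 for
   [t > 0]. *)
Fixpoint srw_prob (t : nat) (x y : V) : R :=
  if t is t'.+1
  then \sum_(z \in nbh x) srw_step x z * srw_prob t' z y
  else (x == y)%:R.

End Graphs.

(* Main.v *)
Require Import Defs.
From mathcomp Require Import all_boot all_order all_algebra finmap.
From mathcomp Require Import all_classical all_reals.
From mathcomp Require Import ring lra zify.
Set Implicit Arguments.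
Unset Strict Implicit.
Unset Printing Implicit Defensive.
Import Order.TTheory GRing.Theory Num.Theory.
Local Open Scope ring_scope.

(** Write p_t for the law of the walk started at x, m = 2 pi(x) and
M = p_s(x) - m with s even.  Reversibility makes j |-> p_2j(x) convex and
nonincreasing with lower bound m, so the decrement D = p_2s(x) - p_(2s+2)(x)
satisfies (s/2 + 1) D <= M.  On the other hand 2 d D is the sum of
(F y - F z)^2 over ordered pairs of adjacent vertices, where
F = p_s + p_(s+1).  Let r be the distance from x to the nearest vertex with
F <= m + M/3.  The sum of F over the ball of radius r - 1 is at most 2, while
in a d-regular graph such a ball has at least about r d / 3 vertices, so
r d <= 36 / M.  Cauchy-Schwarz along a geodesic of length r gives
(2M/3)^2 <= 2 r d D, hence D >= M^3 / 162 and M^2 <= 324 / (s + 2). *)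

(** * Finite sums and elementary inequalities *)

Lemma eq_sum_support (M : nmodType) (T : choiceType) (s B : seq T)
    (g : T -> M) :
    uniq s -> uniq B -> (forall z, g z != 0 -> (z \in s) = (z \in B)) ->
  \sum_(z <- s) g z = \sum_(z <- B) g z.
Proof.
move=> us uB sB.
have E r : \sum_(z <- r) g z = \sum_(z <- r | g z != 0) g z.
  rewrite (bigID (fun z => g z == 0)) /= big1 ?add0r //.
  by move=> z /eqP.
rewrite !E -big_filter -[RHS]big_filter; apply: perm_big.
apply: uniq_perm; rewrite ?filter_uniq // => z; rewrite !mem_filter.
by case: (boolP (g z == 0)) => //= /sB.
Qed.

Lemma ler_sum_subseq (R : numDomainType) (T : choiceType) (s B : seq T)
    (g : T -> R) :
    uniq s -> uniq B -> {subset s <= B} -> (forall z, 0 <= g z) ->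
  \sum_(z <- s) g z <= \sum_(z <- B) g z.
Proof.
move=> us uB sB g0.
rewrite [leRHS](bigID (fun z => z \in s)) /=.
rewrite (perm_big [seq z <- B | z \in s]) /= ?big_filter; last first.
  apply: uniq_perm; rewrite ?filter_uniq // => z; rewrite mem_filter.
  by case: (boolP (z \in s)) => //= /sB.
by rewrite lerDl sumr_ge0.
Qed.

Lemma sum_delta (R : pzSemiRingType) (T : choiceType) (B : seq T) (x : T)
    (g : T -> R) : uniq B -> x \in B ->
  \sum_(y <- B) (x == y)%:R * g y = g x.
Proof.
move=> uB xB; rewrite (bigD1_seq x) //= eqxx mul1r big1 ?addr0 // => y.
by rewrite eq_sym => /negbTE ->; rewrite mul0r.
Qed.

(** Cauchy-Schwarz for the increments of [g], read off the nonnegative sum of the squares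
    [(n * increment - D) ^+ 2], where [D] is the total drop and [n] the number of increments. *)
Lemma telescope_sqr_le (R : realFieldType) (g : nat -> R) (r : nat) :
  (g 0 - g r) ^+ 2 <= r%:R * \sum_(0 <= i < r) (g i - g i.+1) ^+ 2.
Proof.
case: r => [|r]; first by rewrite subrr expr2 !mul0r.
set n : R := r.+1%:R; have n0 : 0 < n by rewrite ltr0n.
set D := g 0%N - g r.+1.
have : 0 <= \sum_(0 <= i < r.+1) (n * (g i - g i.+1) - D) ^+ 2.
  by apply: sumr_ge0 => i _; exact: sqr_ge0.
under eq_bigr => i _ do [rewrite (_ : _ ^+ 2 = n ^+ 2 * (g i - g i.+1) ^+ 2
    + ((- 2 * n * D) * (g i - g i.+1) + D ^+ 2)); last by ring].
rewrite !big_split /= -!mulr_sumr.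
have -> : \sum_(0 <= i < r.+1) (g i - g i.+1) = D.
  rewrite -[RHS]opprK /D opprB -telescope_sumr // -sumrN.
  by apply: eq_bigr => i _; rewrite opprB.
rewrite sumr_const_nat subn0 -mulr_natl -/n.
set S := \sum_(0 <= i < _) _ => H.
have : 0 <= n * (n * S - D ^+ 2).
  by apply: le_trans H _; rewrite le_eqVlt; apply/orP; left; apply/eqP; ring.
by rewrite pmulr_rge0 // subr_ge0.
Qed.

Local Arguments srw_prob : simpl never.

(** The hypothesis says that [i] differs from [k] by at most 1, written without truncated
    subtraction, so [P] holds at no more than three indices. *)
Lemma sum_window_le (R : numDomainType) (P : pred nat) (k m : nat) :
    (forall i, P i -> k <= i.+1 <= k.+2)%N ->
  \sum_(0 <= i < m) (P i)%:R <= 3 :> R.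
Proof.
move=> Pk; rewrite -natr_sum ler_nat.
have -> : (\sum_(0 <= i < m) P i)%N = size [seq i <- index_iota 0 m | P i].
  rewrite size_filter -sum1_count [RHS]big_mkcond.
  by apply: eq_bigr => i _; case: (P i).
rewrite -(size_iota k.-1 3); apply: uniq_leq_size.
  by rewrite filter_uniq ?iota_uniq.
by move=> i; rewrite mem_filter mem_iota => /andP[/Pk ik _]; lia.
Qed.

(** * One-step recursions for the walk on a regular graph *)

Section Walk.
Variables (R : realType) (V : choiceType) (G : simple_graph V) (d : nat).
Hypotheses (G_lf : locally_finite G) (deg_d : forall x, deg G x = d).
Hypothesis d_gt0 : (0 < d)%N.
Local Notation adj := (adj G).
Local Notation p := (srw_prob G R).

Definition neighbours (y : V) : seq V := fset_set (nbh G y).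

Lemma neighbours_uniq y : uniq (neighbours y).
Proof. exact: fset_uniq. Qed.

Lemma size_neighbours y : size (neighbours y) = d.
Proof. by rewrite -(deg_d y). Qed.

Lemma mem_neighbours y z : (z \in neighbours y) = adj y z.
Proof.
by rewrite /neighbours in_fset_set //; apply/idP/idP; rewrite inE.
Qed.

(** With the adjacency indicator as a weight, sums over neighbours run over a common list, where
    they can be exchanged and the symmetry of [adj] applied. *)
Lemma sum_neighbours (g : V -> R) (B : seq V) (y : V) :
    uniq B -> (forall z, adj y z -> g z != 0 -> z \in B) ->
  \sum_(z <- neighbours y) g z = \sum_(z <- B) (adj y z)%:R * g z.
Proof.
move=> uB gB.
transitivity (\sum_(z <- neighbours y) (adj y z)%:R * g z).
  rewrite [LHS]big_seq [RHS]big_seq; apply: eq_bigr => z.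
  by rewrite mem_neighbours => ->; rewrite mul1r.
apply: eq_sum_support => // [|z]; first exact: neighbours_uniq.
rewrite mem_neighbours; case yz: (adj y z); last by rewrite mul0r eqxx.
by rewrite mul1r => /gB ->.
Qed.

Lemma srw_probS t x y :
  p t.+1 x y = d%:R^-1 * \sum_(z <- neighbours x) p t z y.
Proof.
rewrite /srw_prob -/srw_prob (fsbig_finite _ _ (G_lf x)) mulr_sumr.
rewrite big_seq [RHS]big_seq.
apply: eq_bigr => z; rewrite -/(neighbours x) mem_neighbours /srw_step => ->.
by rewrite deg_d.
Qed.

(** Conditioning on the last step instead of the first. Regularity makes the transition matrix
    symmetric, which settles the base case. *)
Lemma srw_probSr t x y :
  p t.+1 x y = d%:R^-1 * \sum_(z <- neighbours y) p t x z.
Proof.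
elim: t x y => [|t IH] x y; last first.
  rewrite srw_probS; under eq_bigr do rewrite IH.
  rewrite -mulr_sumr exchange_big mulr_sumr.
  by congr (_ * _); apply: eq_bigr => z _; rewrite srw_probS.
rewrite srw_probS; congr (_ * _).
rewrite (sum_neighbours (B := [:: y])) //; last first.
  by move=> z _; rewrite /srw_prob pnatr_eq0 eqb0 negbK inE.
rewrite (sum_neighbours (B := [:: x])) //; last first.
  by move=> z _; rewrite /srw_prob pnatr_eq0 eqb0 negbK inE eq_sym.
by rewrite !big_seq1 /srw_prob !eqxx adj_sym.
Qed.

Variable x : V.

Lemma srw_prob_ge0 t y : 0 <= p t x y.
Proof.
elim: t y => [|t IH] y; first exact: ler0n.
by rewrite srw_probSr mulr_ge0 ?invr_ge0 ?ler0n ?sumr_ge0.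
Qed.

Lemma srw_prob_neq0S t y :
  p t.+1 x y != 0 -> exists2 z, adj z y & p t x z != 0.
Proof.
rewrite srw_probSr => H; apply: contrapT => no; case/negP: H; apply/eqP.
rewrite big_seq big1 ?mulr0 // => z; rewrite mem_neighbours adj_sym => zy.
by apply/eqP; apply: contrapT => /negP zt; apply: no; exists z.
Qed.

Lemma srw_prob_colour (c : V -> bool) t y :
    (forall u v, adj u v -> c u != c v) ->
  p t x y != 0 -> c y = c x (+) odd t.
Proof.
move=> cP; elim: t y => [|t IH] y.
  by rewrite /srw_prob pnatr_eq0 eqb0 negbK addbF => /eqP ->.
move=> /(@srw_prob_neq0S t)[z /cP zy /IH]; move: zy => /=.
by case: (c z); case: (c y); case: (c x); case: (odd t).
Qed.

(** * Balls around the starting vertex and the support of the walk *)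

(** Encoded as a duplicate-free list: sums over a possibly infinite vertex set become finite sums
    over any ball containing the support. *)
Fixpoint ball n : seq V :=
  if n is n'.+1
  then undup (ball n' ++ flatten [seq neighbours z | z <- ball n'])
  else [:: x].
Local Arguments ball : simpl never.

Lemma ball_uniq n : uniq (ball n).
Proof. by case: n => // n; exact: undup_uniq. Qed.

Lemma mem_ballS n y :
  reflect (y \in ball n \/ exists2 z, z \in ball n & adj z y)
          (y \in ball n.+1).
Proof.
rewrite /ball -/ball mem_undup mem_cat; apply: (iffP orP) => -[yn|];
  try by left.
  by case/flatten_mapP => z zn; rewrite mem_neighbours; right; exists z.
by case=> z zn zy; right; apply/flatten_mapP; exists z; rewrite ?mem_neighbours.
Qed.

Lemma ball_nondecreasing m n : (m <= n)%N -> {subset ball m <= ball n}.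
Proof.
move=> /subnK <-; elim: (n - m)%N => // k IH y /IH yk.
by apply/mem_ballS; left.
Qed.

Lemma ball_adj n y z : y \in ball n -> adj y z -> z \in ball n.+1.
Proof. by move=> yn yz; apply/mem_ballS; right; exists y. Qed.

Lemma srw_prob_ball t y : p t x y != 0 -> y \in ball t.
Proof.
elim: t y => [|t IH] y; first by rewrite /srw_prob pnatr_eq0 eqb0 negbK inE eq_sym.
by move=> /(@srw_prob_neq0S t)[z zy /IH zt]; exact: ball_adj zy.
Qed.

Lemma srw_prob_supp t n y : (t <= n)%N -> p t x y != 0 -> y \in ball n.
Proof. by move=> tn /srw_prob_ball; exact: ball_nondecreasing. Qed.

Lemma srw_prob_sumSr t n y : (t <= n)%N ->
  p t.+1 x y = d%:R^-1 * \sum_(z <- ball n) (adj y z)%:R * p t x z.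
Proof.
move=> tn; rewrite srw_probSr (sum_neighbours (B := ball n)) ?ball_uniq //.
by move=> z _; exact: srw_prob_supp.
Qed.

Lemma sum_adj n y : {subset neighbours y <= ball n} ->
  \sum_(z <- ball n) (adj y z)%:R = d%:R :> R.
Proof.
move=> yn; transitivity (\sum_(z <- neighbours y) (1 : R)); last first.
  by rewrite big_const_seq count_predT size_neighbours -Monoid.iteropE.
rewrite (sum_neighbours (B := ball n)) ?ball_uniq //.
  by apply: eq_bigr => z _; rewrite mulr1.
by move=> z yz _; apply: yn; rewrite mem_neighbours.
Qed.

(** Conservation of mass: each [z] charged at step [t] shares its mass among [d] neighbours, all of
    which lie in [ball n] when [t < n]. *)
Lemma sum_srw_prob t n : (t <= n)%N -> \sum_(y <- ball n) p t x y = 1.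
Proof.
elim: t => [|t IH] tn.
  under eq_bigr do rewrite -[p 0 x _]mulr1.
  by rewrite sum_delta ?ball_uniq // (ball_nondecreasing (leq0n n)) ?mem_head.
rewrite -IH 1?ltnW //.
under eq_bigr do rewrite (@srw_prob_sumSr t n) 1?ltnW //.
rewrite -mulr_sumr exchange_big /= mulr_sumr.
apply: eq_bigr => z _.
have [->|/srw_prob_ball zt] := eqVneq (p t x z) 0.
  by under eq_bigr do rewrite mulr0; rewrite big1 // mulr0.
under eq_bigr do rewrite adj_sym.
rewrite -mulr_suml sum_adj ?mulKf ?pnatr_eq0 -?lt0n // => w.
by rewrite mem_neighbours => /(ball_adj zt); exact: ball_nondecreasing.
Qed.

(** * Reversibility and convexity of the even return probabilities *)

(** Symmetry of the transition matrix moves steps one at a time from the first factor to the second,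
    until the first is the unit mass at [x]. *)
Lemma sum_srw_prob_mul a b n : (a + b <= n)%N ->
  \sum_(y <- ball n) p a x y * p b x y = p (a + b) x x.
Proof.
elim: a b => [|a IH] b abn.
  by rewrite sum_delta ?ball_uniq // (ball_nondecreasing (leq0n n)) ?mem_head.
have an : (a <= n)%N by lia.
have bn : (b <= n)%N by lia.
rewrite addSnnS -IH; last by lia.
under eq_bigr do rewrite (srw_prob_sumSr _ an) -mulrA mulr_suml mulr_sumr.
under [RHS]eq_bigr do rewrite (srw_prob_sumSr _ bn) mulrCA mulr_sumr mulr_sumr.
rewrite exchange_big; apply: eq_bigr => z _; apply: eq_bigr => y _.
by rewrite adj_sym; ring.
Qed.

(* Convexity of [j |-> p (2 * j) x x], read off [|| p_j - p_(j+2) ||^2 >= 0]. *)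
Lemma srw_prob_convex j :
  2 * p (2 * j.+1) x x <= p (2 * j) x x + p (2 * j.+2) x x.
Proof.
have : 0 <= \sum_(y <- ball (2 * j.+2)) (p j x y - p j.+2 x y) ^+ 2.
  by apply: sumr_ge0 => y _; exact: sqr_ge0.
under eq_bigr => y _ do [rewrite (_ : _ ^+ 2 = p j x y * p j x y +
    (- 2 * (p j x y * p j.+2 x y) + p j.+2 x y * p j.+2 x y)); last by ring].
rewrite !big_split /= -mulr_sumr !sum_srw_prob_mul; try lia.
have -> : (j + j = 2 * j)%N by lia.
have -> : (j + j.+2 = 2 * j.+1)%N by lia.
have -> : (j.+2 + j.+2 = 2 * j.+2)%N by lia.
lra.
Qed.

(** By convexity the successive decrements are nonincreasing, so [n.+1] times the last one is at
    most their telescoping sum. *)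
Lemma srw_prob_decrement k n :
  (n.+1)%:R * (p (2 * (k + n)) x x - p (2 * (k + n).+1) x x) <=
    p (2 * k) x x - p (2 * (k + n).+1) x x.
Proof.
elim: n => [|n IH]; first by rewrite addn0 mul1r.
have := srw_prob_convex (k + n).
rewrite -addn1 natrD !addnS.
move: IH; set D := p (2 * (k + n)) x x; set D1 := p (2 * (k + n).+1) x x.
set D2 := p (2 * (k + n).+2) x x => IH conv.
have : n.+1%:R * (D1 - D2) <= n.+1%:R * (D - D1).
  by apply: ler_wpM2l; [exact: ler0n | lra].
move: IH conv; lra.
Qed.

(** * Bipartiteness, the profile and its Dirichlet energy *)

Variable c : V -> bool.
Hypothesis cP : forall u v, adj u v -> c u != c v.

Lemma srw_prob_odd t : odd t -> p t x x = 0.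
Proof.
move=> ot; apply/eqP; apply: contraT => /(srw_prob_colour cP).
by rewrite ot; case: (c x).
Qed.

(* The two summands live on different colour classes. *)
Definition profile s y := p s x y + p s.+1 x y.

Lemma profile_ge0 s y : 0 <= profile s y.
Proof. by rewrite addr_ge0 ?srw_prob_ge0. Qed.

Lemma profile_supp s y : profile s y != 0 -> y \in ball s.+1.
Proof.
rewrite /profile; have [->|ys _] := eqVneq (p s x y) 0.
  by rewrite add0r; exact: srw_prob_ball.
exact: srw_prob_supp ys.
Qed.

Lemma sum_profile s n : (s.+1 <= n)%N -> \sum_(y <- ball n) profile s y = 2.
Proof. by move=> sn; rewrite big_split /= !sum_srw_prob ?(ltnW sn). Qed.

(** Expanding the square gives [2 * d] times the sum of [F ^+ 2] minus the sum of [F] against its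
    one-step average. Odd return probabilities vanish, so these sums are [p_2s + p_(2s+2)] and
    [2 p_(2s+2)]. The longest product that occurs has [2 * s + 3] steps, whence the bound on [n]. *)
Lemma profile_energy s n : ~~ odd s -> (2 * s + 3 <= n)%N ->
  \sum_(y <- ball n) \sum_(z <- ball n)
     (adj y z)%:R * (profile s y - profile s z) ^+ 2 =
  2 * d%:R * (p (2 * s) x x - p (2 * s.+1) x x).
Proof.
move=> es sn; set F := profile s.
have sqE : \sum_(y <- ball n) \sum_(z <- ball n) (adj y z)%:R * F y ^+ 2 =
    d%:R * \sum_(y <- ball n) F y ^+ 2.
  rewrite mulr_sumr; apply: eq_bigr => y _; rewrite -mulr_suml.
  have [->|/profile_supp ys] := eqVneq (F y) 0; first by rewrite expr0n !mulr0.
  rewrite sum_adj // => z; rewrite mem_neighbours => /(ball_adj ys).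
  by apply: ball_nondecreasing; lia.
have crossE : \sum_(y <- ball n) \sum_(z <- ball n) (adj y z)%:R * (F y * F z) =
    d%:R * \sum_(y <- ball n) F y * (p s.+1 x y + p s.+2 x y).
  rewrite mulr_sumr; apply: eq_bigr => y _.
  rewrite !(@srw_prob_sumSr _ n); try lia.
  rewrite -mulrDr mulrCA mulVKf ?pnatr_eq0 -?lt0n // -big_split mulr_sumr.
  by apply: eq_bigr => z _; rewrite /F /profile /=; ring.
under eq_bigr => y _ do under eq_bigr => z _ do
  [rewrite (_ : _ * _ = (adj y z)%:R * F y ^+ 2 +
    (- 2 * ((adj y z)%:R * (F y * F z)) + (adj y z)%:R * F z ^+ 2));
   last by ring].
under eq_bigr => y _ do rewrite !big_split /= -mulr_sumr.
rewrite !big_split /= -mulr_sumr sqE crossE.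
have -> : \sum_(y <- ball n) \sum_(z <- ball n) (adj y z)%:R * F z ^+ 2 =
    \sum_(y <- ball n) \sum_(z <- ball n) (adj y z)%:R * F y ^+ 2.
  rewrite exchange_big; apply: eq_bigr => y _; apply: eq_bigr => z _.
  by rewrite adj_sym.
rewrite sqE.
under eq_bigr => y _ do [rewrite (_ : _ ^+ 2 = p s x y * p s x y +
    (2 * (p s x y * p s.+1 x y) + p s.+1 x y * p s.+1 x y));
  last by rewrite /F /profile; ring].
under [in X in _ + (X + _)]eq_bigr => y _ do
  [rewrite (_ : _ * _ = p s x y * p s.+1 x y + (p s x y * p s.+2 x y
    + (p s.+1 x y * p s.+1 x y + p s.+1 x y * p s.+2 x y)));
   last by rewrite /F /profile; ring].
rewrite !big_split /= -!mulr_sumr !sum_srw_prob_mul; try lia.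
rewrite (@srw_prob_odd (s + s.+1)); last by lia.
rewrite (@srw_prob_odd (s.+1 + s.+2)); last by lia.
have -> : (s + s = 2 * s)%N by lia.
have -> : (s + s.+2 = 2 * s.+1)%N by lia.
have -> : (s.+1 + s.+1 = 2 * s.+1)%N by lia.
ring.
Qed.

(** * Distance, geodesics, and the volume and energy along a geodesic *)

Hypothesis G_conn : connected G.

Lemma ball_exhaust y : exists n, y \in ball n.
Proof.
have [s + <-] := G_conn x y.
have : x \in ball 0 by rewrite mem_head.
move: {1 2 3}x 0%N; elim: s => [|z s IH] u n un /=; first by exists n.
by case/andP=> /(ball_adj un) zn /(IH _ _ zn).
Qed.

Definition dist y : nat := ex_minn (ball_exhaust y).

Lemma dist_ball y : y \in ball (dist y).
Proof. by rewrite /dist; case: ex_minnP. Qed.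

Lemma dist_le n y : y \in ball n -> (dist y <= n)%N.
Proof. by rewrite /dist; case: ex_minnP => k _ /[apply]. Qed.

Lemma dist_eq0 y : dist y = 0%N -> y = x.
Proof. by move=> y0; have := dist_ball y; rewrite y0 inE => /eqP. Qed.

Lemma dist_adj y z : adj y z -> (dist z <= (dist y).+1)%N.
Proof. by move=> yz; apply: dist_le; exact: ball_adj (dist_ball y) yz. Qed.

(** Only the values of [v] up to index [r] matter; [dist (v 0) = 0] makes it start at [x]. *)
Definition geodesic r (v : nat -> V) :=
  (forall i, (i <= r)%N -> dist (v i) = i) /\
  (forall i, (i < r)%N -> adj (v i) (v i.+1)).

Lemma geodesic_exists r y : dist y = r -> exists2 v, geodesic r v & v r = y.
Proof.
elim: r y => [|r IH] y yr.
  by exists (fun=> y) => //; split => // i; rewrite leqn0 => /eqP ->.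
have /mem_ballS[/dist_le|[z /dist_le zr zy]] : y \in ball r.+1.
- by rewrite -yr dist_ball.
- by rewrite yr ltnn.
have /IH[v [vd va] vr] : dist z = r by have := dist_adj zy; lia.
exists (fun i => if (i <= r)%N then v i else y); last by rewrite ltnn.
split=> i ir; first by case: ifP => [/vd //|]; lia.
case: (ltngtP i r) ir => [ir _| |-> _]; [exact: va | lia | by rewrite vr].
Qed.

(* A vertex has at most three neighbours on a geodesic, so the neighbourhoods of
   the first [r - 1] vertices overlap at most threefold. *)
Lemma geodesic_sum_le (F : V -> R) (a : R) (r n : nat) (v : nat -> V) :
    geodesic r v -> (r <= n)%N -> (forall y, 0 <= F y) ->
    (forall y, (dist y < r)%N -> a <= F y) ->
  r.-1%:R * d%:R * a <= 3 * \sum_(y <- ball n) F y.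
Proof.
move=> [vd _] rn F0 aF.
apply: (@le_trans _ _ (\sum_(0 <= i < r.-1)
    \sum_(w <- ball n) (adj (v i) w)%:R * F w)).
  rewrite -mulrA -[r.-1 in leLHS]subn0 mulr_natl -sumr_const_nat.
  (* As [i < r.-1], all [d] neighbours of [v i] are at distance less than [r], where [F] is at least
     [a]. *)
  apply: ler_sum_nat => i /andP[_ ir].
  have vi : dist (v i) = i by apply: vd; lia.
  rewrite -(@sum_adj n (v i)); last first.
    move=> w; rewrite mem_neighbours => /dist_adj; rewrite vi => wi.
    by apply: ball_nondecreasing (dist_ball w); lia.
  rewrite mulr_suml; apply: ler_sum => w _.
  case iw: (adj (v i) w); rewrite ?mul0r // !mul1r; apply: aF.
  by have := dist_adj iw; lia.
rewrite exchange_big mulr_sumr; apply: ler_sum => w _.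
rewrite -mulr_suml; apply: ler_wpM2r => //.
(* The index bound is moved into the predicate, since [dist (v i) = i] is known only up to [r]. *)
have -> : \sum_(0 <= i < r.-1) (adj (v i) w)%:R =
    \sum_(0 <= i < r.-1) ((i < r.-1) && adj (v i) w)%N%:R :> R.
  by rewrite !big_nat; apply: eq_bigr => i /andP[_ ->].
apply: (@sum_window_le _ _ (dist w)) => i /andP[ir iw].
have vi : dist (v i) = i by apply: vd; lia.
have := dist_adj iw; have : adj w (v i) by rewrite adj_sym.
by move=> /dist_adj; lia.
Qed.

(** The vertices [v i] are distinct because their distances are. Keeping only the ordered pairs
    [(v i, v i.+1)] discards nonnegative terms. *)
Lemma geodesic_energy_le (F : V -> R) (r n : nat) (v : nat -> V) :
    geodesic r v -> (r <= n)%N ->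
  \sum_(0 <= i < r) (F (v i) - F (v i.+1)) ^+ 2 <=
  \sum_(y <- ball n) \sum_(z <- ball n) (adj y z)%:R * (F y - F z) ^+ 2.
Proof.
move=> [vd va] rn.
have vB i : (i <= r)%N -> v i \in ball n.
  by move=> ir; apply: ball_nondecreasing (dist_ball _);
    rewrite vd ?(leq_trans ir).
have E0 y z : 0 <= (adj y z)%:R * (F y - F z) ^+ 2.
  by rewrite mulr_ge0 ?ler0n ?sqr_ge0.
apply: (@le_trans _ _ (\sum_(y <- [seq v i | i <- index_iota 0 r])
    \sum_(z <- ball n) (adj y z)%:R * (F y - F z) ^+ 2)).
  rewrite big_map; apply: ler_sum_nat => i /andP[_ ir].
  apply: (@le_trans _ _ (\sum_(z <- [:: v i.+1])
      (adj (v i) z)%:R * (F (v i) - F z) ^+ 2)).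
    by rewrite big_seq1 va // mul1r.
  apply: ler_sum_subseq => //; first exact: ball_uniq.
  by move=> z; rewrite inE => /eqP ->; exact: vB.
apply: ler_sum_subseq; last by move=> y; exact: sumr_ge0.
- rewrite map_inj_in_uniq ?iota_uniq // => i j.
  rewrite !mem_index_iota => ir jr.
  by move=> /(congr1 dist); rewrite !vd; lia.
- exact: ball_uniq.
- by move=> y /mapP[i]; rewrite mem_index_iota => ir ->; apply: vB; lia.
Qed.

(** * The upper bound *)

Lemma srw_prob_upper (m : R) (s : nat) :
    ~~ odd s -> (2 <= s)%N -> 0 <= m -> (forall k, m <= p (2 * k) x x) ->
    (exists y, profile s y <= m) ->
  p s x x - m <= 18 / Num.sqrt s%:R.
Proof.
move=> es s2 m0 mp [y0 y0m].
set M := p s x x - m.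
have s0 : 0 < s%:R :> R by rewrite ltr0n; lia.
have [M0|M0] := leP M 0.
  by apply: le_trans M0 _; rewrite divr_ge0 ?sqrtr_ge0.
(* Here [324 = 18 ^ 2]; replacing [s + 2] by [s] and taking square roots gives the claim. *)
suff M2 : M ^+ 2 * (s%:R + 2) <= 324.
  rewrite ler_pdivlMr ?sqrtr_gt0 //.
  rewrite -(@ler_pXn2r _ 2) ?nnegrE ?mulr_ge0 ?sqrtr_ge0 ?(ltW M0) //.
  rewrite exprMn sqr_sqrtr ?(ltW s0) //.
  have : 0 <= M ^+ 2 by exact: sqr_ge0.
  by move: M2; nra.
have sE : (2 * s./2 = s)%N by lia.
have hs : s./2%:R = s%:R / 2 :> R.
  by rewrite -[in RHS]sE natrM mulrC mulKf // pnatr_eq0.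
(* If the return probability halves in one double step, convexity alone gives
   the bound; otherwise [d * M <= 2], which settles the case [r = 1] below. *)
have [half|half] := leP (2 * p s.+2 x x) (p s x x).
  have ps1 : p s x x <= 1.
    rewrite -(@sum_srw_prob s s) // (bigD1_seq x) ?ball_uniq //=.
      by rewrite lerDl sumr_ge0 // => z _; exact: srw_prob_ge0.
    by apply: (ball_nondecreasing (leq0n s)); rewrite mem_head.
  have := srw_prob_decrement 0 s./2; rewrite add0n sE.
  have -> : (2 * (s./2).+1 = s.+2)%N by lia.
  rewrite -natr1 hs.
  have -> : p (2 * 0) x x = 1 by rewrite muln0 /srw_prob eqxx.
  have := srw_prob_ge0 s.+2 x.
  move: M0 (s0) half ps1 m0; rewrite /M; set u := p s x x; set w := p s.+2 x x.
  move=> *.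
  (* The decrement bound started at time 0 gives [(s/2 + 1) (u - w) <= 1], and [w <= u/2]. Since
     also [u - m <= 1], the product with [u - m] is at most 4. *)
  have h1 : (s%:R + 2) * (u - m) <= 4 by nra.
  have : (s%:R + 2) * (u - m) * (u - m) <= 4 * 1 by apply: ler_pM; nra.
  by rewrite expr2; nra.
set F := profile s.
have Fx : F x = m + M.
  by rewrite /F /profile (@srw_prob_odd s.+1) ?oddS // /M; lra.
(* The level [u * M] with [u = 1 / 3] maximizes [(1 - u)^2 * u], the factor in
   the resulting lower bound for the decrement. *)
pose a := m + M / 3.
(* [d * p s.+2 x x] is the mass on the neighbours of [x] at step [s.+1], hence at most 1, while
   [M <= p s x x < 2 * p s.+2 x x]. *)
have Dx : d%:R * M <= 2.
  have : d%:R * p s.+2 x x <= 1.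
    rewrite srw_probSr mulVKf ?pnatr_eq0 -?lt0n // -(@sum_srw_prob s.+1 s.+1) //.
    rewrite (sum_neighbours (B := ball s.+1)) ?ball_uniq //; last first.
      by move=> z _; exact: srw_prob_ball.
    apply: ler_sum => z _; case: (adj x z); rewrite ?mul1r ?mul0r //.
    exact: srw_prob_ge0.
  have : 0 <= d%:R :> R by exact: ler0n.
  by move: half m0; rewrite /M; nra.
have ex : exists r, `[< exists2 y, dist y = r & F y <= a >].
  exists (dist y0); apply/asboolP; exists y0 => //.
  by apply: le_trans y0m _; rewrite /a lerDl divr_ge0 ?(ltW M0).
case: (ex_minnP ex) => r /asboolP[y yr ya] rmin.
have aF w : (dist w < r)%N -> a <= F w.
  move=> wr; rewrite leNgt; apply/negP => wa.
  by have := rmin (dist w); rewrite leqNgt wr => /(_ _)/negP; apply => //;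
     apply/asboolP; exists w => //; exact: ltW.
have [v vg vr] := geodesic_exists yr.
have v0 : v 0%N = x by apply: dist_eq0; apply: vg.1.
(* At distance 0 the profile is [m + M], which exceeds [a]. *)
have r0 : (0 < r)%N.
  rewrite lt0n; apply/eqP => re; move: ya; rewrite -vr re v0 Fx /a.
  by move: M0; lra.
pose n := (2 * s + 3 + r)%N.
have rn : (r <= n)%N by rewrite leq_addl.
have vol := geodesic_sum_le vg rn (profile_ge0 s) aF.
rewrite sum_profile in vol; last by lia.
have en := geodesic_energy_le F vg rn.
rewrite profile_energy // in en; last by lia.
have tel := telescope_sqr_le (fun i => F (v i)) r.
rewrite /= v0 vr Fx in tel.
have dec := srw_prob_decrement s./2 s./2.
rewrite sE (_ : s./2 + s./2 = s)%N in dec; last by lia.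
have low := mp s.+1.
move: dec en; rewrite -natr1 hs; set D := p (2 * s) x x - _.
move=> dec en.
(* The subtracted return probability is at least [m], so the right-hand side is at most [M]. *)
have {}dec : (s%:R / 2 + 1) * D <= M.
  by apply: le_trans dec _; rewrite /M lerD2l lerN2.
(* For [r = 1] this is [Dx]. Otherwise the volume bound, with total mass 2 and overlap 3, gives
   [(r - 1) d M / 3 <= 6], and [r <= 2 (r - 1)] doubles the resulting 18. *)
have rdM : r%:R * d%:R * M <= 36.
  have [r1|r1] := leqP r 1.
    have -> : r = 1%N by lia.
    by rewrite mul1r; move: Dx; lra.
  have rE : r%:R = r.-1%:R + 1 :> R by rewrite natr1 prednK.
  have r1' : 1 <= r.-1%:R :> R by rewrite ler1n; lia.
  have d0 : 0 <= d%:R :> R by exact: ler0n.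
  have rd0 : 0 <= r.-1%:R * d%:R :> R by rewrite mulr_ge0 ?ler0n.
  have h1 : r.-1%:R * d%:R * (M / 3) <= 6.
    apply: le_trans (_ : r.-1%:R * d%:R * a <= _); last by move: vol; lra.
    by apply: ler_wpM2l => //; rewrite /a lerDr.
  have h2 : r%:R * d%:R <= 2 * (r.-1%:R * d%:R) :> R by rewrite rE; nra.
  by move: (ler_wpM2r (ltW M0) h2) h1; lra.
(* The profile drops by at least [2 M / 3] along the geodesic, whose energy is at most [2 d D]. *)
have grad : 4 / 9 * M ^+ 2 <= 2 * (r%:R * d%:R) * D.
  apply: le_trans (_ : r%:R * (2 * d%:R * D) <= _); last by lra.
  apply: le_trans (ler_wpM2l (ler0n _ _) en).
  apply: le_trans tel.
  have : 2 / 3 * M <= m + M - F y by move: ya; rewrite /a; lra.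
  by move: M0; nra.
have D0 : 0 <= D.
  rewrite leNgt; apply/negP => Dn.
  have : 0 < M ^+ 2 by rewrite exprn_gt0.
  have : 0 <= r%:R * d%:R :> R by rewrite mulr_ge0 ?ler0n.
  by move: Dn grad; nra.
(* Multiplying [grad] by [M] and using [r d M <= 36] gives [4/9 M^3 <= 72 D]. *)
have cube : M ^+ 3 <= 162 * D.
  have : 4 / 9 * M ^+ 2 * M <= 2 * (r%:R * d%:R) * D * M.
    by apply: ler_wpM2r => //; exact: ltW.
  have : r%:R * d%:R * M * D <= 36 * D by apply: ler_wpM2r.
  by rewrite exprS; lra.
(* After multiplication by [M], the goal follows from [(s/2 + 1) M^3 <= 162 (s/2 + 1) D <= 162
   M]. *)
rewrite -(ler_pM2r M0).
have : (s%:R / 2 + 1) * M ^+ 3 <= (s%:R / 2 + 1) * (162 * D).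
  by apply: ler_wpM2l => //; move: s0; lra.
by move: dec; rewrite exprS; lra.
Qed.

(** * Colour classes and the stationary measure *)

Lemma colour_inhabited b : exists y, c y == b.
Proof.
have : (0 < size (neighbours x))%N by rewrite size_neighbours.
case E: (neighbours x) => [//|y l] _.
have /cP : adj x y by rewrite -mem_neighbours E mem_head.
have [xb _|xb xy] := boolP (c x == b); first by exists x.
by exists y; move: xb xy; case: (c x) (c y) b => -[] [].
Qed.

(** Each edge has exactly one endpoint of colour [b], so edges correspond bijectively to pairs of a
    vertex of colour [b] and one of its [d] neighbours. *)
Lemma edges_card W b : uniq W -> (forall y, y \in W) ->
  #|` fset_set (edges G)| = (count (fun y => c y == b) W * d)%N.
Proof.
move=> uW W_all.
pose A := [seq y <- W | c y == b].
pose E := [seq [fset y; z]%fset | y <- A, z <- neighbours y].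
have memE e : (e \in E) = `[< edges G e >].
  apply/idP/asboolP.
    case/allpairsPdep => y [z [_]]; rewrite mem_neighbours => yz ->.
    by exists y, z.
  move=> [y [z [yz ->]]]; apply/allpairsPdep.
  have [yb|yb] := boolP (c y == b).
    by exists y, z; rewrite mem_filter yb W_all mem_neighbours.
  exists z, y; rewrite mem_filter W_all mem_neighbours adj_sym yz fsetUC.
  split=> //; rewrite andbT; move: (cP yz) yb.
  by case: (c y); case: (c z); case: (b).
have edges_fin : finite_set (edges G).
  apply: (@sub_finite_set _ _ [set` E]%classic); last exact: finite_seq.
  by move=> e eE /=; rewrite memE; apply/asboolP.
have uE : uniq E.
  apply: allpairs_uniq_dep; first by rewrite filter_uniq.
    by move=> y _; exact: neighbours_uniq.
  move=> [y z] [y' z'] /allpairsPdep[u [w [+ + [-> ->]]]].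
  rewrite mem_filter mem_neighbours => /andP[/eqP ub _] uw.
  move=> /allpairsPdep[u' [w' [+ + [-> ->]]]].
  rewrite mem_filter mem_neighbours => /andP[/eqP ub' _] uw' /= E2.
  have /cP wb := uw; have /cP wb' := uw'.
  have : u \in [fset u'; w']%fset by rewrite -E2 fset21.
  rewrite in_fset2 => /orP[/eqP uu|/eqP uu]; last first.
    by move: wb'; rewrite -uu ub ub' eqxx.
  have : w \in [fset u'; w']%fset by rewrite -E2 fset22.
  rewrite in_fset2 => /orP[/eqP wu|/eqP ->]; last by rewrite uu.
  by move: wb; rewrite wu ub ub' eqxx.
transitivity (size E).
  apply: perm_size; apply: uniq_perm => // e; rewrite memE in_fset_set //.
rewrite /E size_allpairs_dep -size_filter -/A.
by elim: (A) => //= y l ->; rewrite size_neighbours mulSn.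
Qed.

(** Since [|E|] is [d] times the class size, [2 pi = d / |E|] is the inverse of that size, for
    either colour. *)
Lemma pi_stat_count W b : uniq W -> (forall y, y \in W) ->
  (count (fun y => c y == b) W)%:R * (2 * pi_stat G R x) = 1.
Proof.
move=> uW W_all; rewrite /pi_stat asboolT; last first.
  by apply: (@sub_finite_set _ _ [set` W]%classic) (finite_seq W) => y _ /=.
have W0 : (count (fun y => c y == b) W)%:R != 0 :> R.
  rewrite pnatr_eq0 -lt0n -has_count; apply/hasP.
  by have [y yb] := colour_inhabited b; exists y.
have d0 : d%:R != 0 :> R by rewrite pnatr_eq0 -lt0n.
by rewrite (@edges_card W b) // deg_d natrM; field; rewrite W0 d0.
Qed.

Lemma pi_stat_cases :
  (exists W, [/\ uniq W, forall y, y \in W &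
     forall b, (count (fun y => c y == b) W)%:R * (2 * pi_stat G R x) = 1]) \/
  (2 * pi_stat G R x = 0 /\ forall s : seq V, exists y, y \notin s).
Proof.
have [fV|iV] := pselect (finite_set [set: V]); [left | right].
  exists (fset_set [set: V]); have W_all y : y \in fset_set [set: V].
    by rewrite in_fset_set // inE.
  by split=> // b; apply: pi_stat_count => //; exact: fset_uniq.
split; first by rewrite /pi_stat asboolF // mulr0.
move=> s; apply: contrapT => no; apply: iV.
apply: (@sub_finite_set _ _ [set` s]%classic) (finite_seq s) => y _ /=.
by apply/negPn/negP => ys; apply: no; exists y.
Qed.

Lemma sum_full (W : seq V) (n : nat) (g : V -> R) :
    uniq W -> (forall y, y \in W) -> (forall y, g y != 0 -> y \in ball n) ->
  \sum_(y <- W) g y = \sum_(y <- ball n) g y.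
Proof.
move=> uW W_all gn; apply: eq_sum_support; rewrite ?ball_uniq // => y /gn ->.
exact: W_all.
Qed.

(** * The lower bound and a vertex of low profile *)

Lemma srw_prob_lower k : 2 * pi_stat G R x <= p (2 * k) x x.
Proof.
have [[W [uW W_all Wm]]|[-> _]] := pi_stat_cases; last exact: srw_prob_ge0.
set m := 2 * _ in Wm *.
pose b := c x (+) odd k.
(* Cauchy-Schwarz on the colour class supporting [p k x], of size [1 / m]. *)
have : 0 <= \sum_(y <- W | c y == b) (p k x y - m) ^+ 2.
  by apply: sumr_ge0 => y _; exact: sqr_ge0.
under eq_bigr => y _ do [rewrite (_ : _ ^+ 2 =
  p k x y * p k x y + (- 2 * m * p k x y + m ^+ 2)); last by ring].
rewrite !big_split /= -mulr_sumr.
(* At step [k] the walk is on colour [b], so restricting to that class loses nothing. *)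
have colour_sum (g : V -> R) : (forall y, p k x y = 0 -> g y = 0) ->
    \sum_(y <- W | c y == b) g y = \sum_(y <- ball (k + k)) g y.
  move=> g0; rewrite -(@sum_full W) // => [|y gy].
    rewrite [RHS](bigID (fun y => c y == b)) /=.
    rewrite [X in _ + X]big1 ?addr0 // => y yb.
    by apply: g0; apply/eqP; apply: contraNT yb => /(srw_prob_colour cP) ->.
  apply: (@srw_prob_supp k); first by rewrite leq_addr.
  by apply: contraNneq gy => /g0 ->.
rewrite (colour_sum (fun y => p k x y * p k x y)); last first.
  by move=> y ->; rewrite mul0r.
rewrite (colour_sum (p k x)) //.
rewrite sum_srw_prob_mul // sum_srw_prob ?leq_addr //.
rewrite big_const_seq iter_addr_0 -[_ *+ count _ _]mulr_natl.
(* The class has [1 / m] vertices, so the constant terms [m ^+ 2] add up to [m] and the whole sum is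
   [p (2 * k) x x - m]. *)
rewrite expr2 mulrA Wm addnn mul2n.
by lra.
Qed.

(** If [V] is infinite, the profile vanishes outside a ball. If [V] is finite, averaging suffices:
    the profile has total mass 2, and so has the constant [m], with mass 1 on each colour class. *)
Lemma profile_low s : exists y, profile s y <= 2 * pi_stat G R x.
Proof.
have [[W [uW W_all Wm]]|[-> /(_ (ball s.+1))[y yB]]] := pi_stat_cases;
  last first.
  exists y; rewrite le_eqVlt; apply/orP; left.
  by apply: contraNT yB => /profile_supp.
set m := 2 * _ in Wm *; apply: contrapT => no.
have gt y : m < profile s y.
  by rewrite ltNge; apply/negP => ym; apply: no; exists y.
have : 0 < \sum_(y <- W) (profile s y - m).
  rewrite (bigD1_seq x) //= ltr_wpDr ?subr_gt0 //.
  by apply: sumr_ge0 => y _; rewrite subr_ge0 ltW.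
rewrite big_split /= (@sum_full W s.+1) //; last exact: profile_supp.
rewrite sum_profile // sumrN big_const_seq iter_addr_0 count_predT.
rewrite -[_ *+ size _]mulr_natl -(count_predC (fun y => c y == true) W).
rewrite natrD mulrDl.
rewrite Wm.
rewrite (_ : count _ W = count (fun y => c y == false) W); last first.
  by apply: eq_count => y /=; case: (c y).
by rewrite Wm; lra.
Qed.

End Walk.

Theorem theorem1p7 (R : realType) (V : choiceType) (G : simple_graph V)
  (G_lf : locally_finite G) (G_reg : regular G) (G_bip : bipartite G)
  (G_conn : connected G) (x : V) (t : nat) (t_even : ~~ odd t)
  (t_ge2 : (2 <= t)%N) :
  0 <= srw_prob G R t x x - 2 * pi_stat G R x <= 18 / Num.sqrt t%:R.
Proof.
have [d degd] := G_reg; have [c cP] := G_bip.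
have [d0|d0] := posnP d.
  (* In degree 0 both the return probability at a positive time and [pi_stat] take the value 0, so
     the difference is 0. *)
  have nbh0 y : nbh G y = set0.
    apply: fset_set_set0; first exact: G_lf.
    by apply/eqP; rewrite -cardfs_eq0 -d0 -(degd y).
  have -> : srw_prob G R t x x = 0.
    by case: t t_ge2 {t_even} => // t _; rewrite /srw_prob nbh0 fsbig_set0.
  rewrite /pi_stat degd d0 mul0r if_same mulr0 subr0 lexx.
  by rewrite divr_ge0 ?sqrtr_ge0.
have low k := srw_prob_lower R G_lf degd d0 x cP k.
rewrite subr_ge0.
have tE : (2 * t./2 = t)%N by lia.
apply/andP; split; first by rewrite -[in leRHS]tE.
apply: (srw_prob_upper G_lf degd d0 cP G_conn) => //.
- rewrite mulr_ge0 // /pi_stat; case: ifP => // _.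
  by rewrite divr_ge0 ?mulr_ge0 ?ler0n.
- exact: (profile_low R G_lf degd d0 x cP).
Qed.
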